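(* For every size-stable time $t$ and all $0\le i\le n$, $x_i(t)\in X(t)$ belongs to a level-$j$ chain (for some $j$).
   Context: Model. $X=\{x_0,x_1,\dots,x_n\}$ is a finite set of robots on the real line; $x(t)$ is the position of robot $x$ at the discrete time $t=0,1,2,\dots$, and $X(t)=\{x_0(t),\dots,x_n(t)\}$ (the same symbol may denote a robot and its position). Initial positions are arbitrary, and robots need not occupy distinct positions. Exactly two robots are faulty and never move: $x_0$ is the leftmost faulty robot and $x_n$ the rightmost faulty robot, with $x_0(t)=0$ and $x_n(t)$ equal to a fixed positive number for all $t\ge0$. $V>0$ is the visibility radius. $N(x(t))$ is the set of robots $y$ with $|x(t)-y(t)|\le V$ (so $x$ itself belongs to it); $l(x(t))$ and $r(x(t))$ denote the leftmost and the rightmost robot in $N(x(t))$. All robots act synchronously: every non-faulty robot $x$ satisfies $x(t+1)=\frac{l(x(t))+r(x(t))}{2}$ for all $t\ge 0$. Non-faulty robots that end up in the same position merge: they behave identically and are considered as a single robot from then on. Size-stable time. A time $t_0$ is size-stable if, for all $t\ge t_0$: (i) there will be no inclusions (a robot entering the visibility range of a robot that did not see it before), mergings (robots coming to occupy the same position) or crossings (two robots exchanging their order on the line) in the system; and (ii) either all robots are inside the line segment $[x_0,x_n]$, or at most one robot is on each side of $[x_0,x_n]$ and stays outside of $[x_0,x_n]$; moreover, the two outsiders (those that exist) converge to $x_0$ and $x_n$, respectively. It is assumed that the earliest size-stable time is $0$, so that every $t\ge 0$ is size-stable. Chains. Let $m$ be an integer with $0\le m\le n$. A mutual chain at a size-stable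 time $t$ is a configuration $\{z_1(t),\dots,z_m(t)\}\subset X(t)$ of $m$ robots such that $l(z_{i+1}(t))=z_i(t)$ and $r(z_i(t))=z_{i+1}(t)$ for all $1\le i\le m-1$. Its left and right anchors are $l(z_1(t))$ and $r(z_m(t))$, and it is said to be anchored at these; anchors may belong to the chain, and a chain may consist of a single robot. Levels. By convention, the faulty robot $x_0$ is part of the level-$0$ chain $\{x_0\}$ and the faulty robot $x_n$ is part of the level-$0$ chain $\{x_n\}$. The primary chain $\mathcal{C}_1=\{x_0',x_1',\dots,x_k'\}\subseteq X$ is the unique mutual chain anchored at $x_0$ and $x_n$ with $x_0'=x_0$ and $x_k'=x_n$; it is called a level-$1$ chain. A secondary chain is a mutual chain anchored at two robots $x,x'\in\mathcal{C}_1$ at least one of which is non-faulty; it is called a level-$2$ chain. For $j>2$, a configuration of robots is a level-$j$ chain if it is a mutual chain anchored at two robots $x$ and $x'$ for which there exists an index $j'<j$ such that either $x$ is part of a level-$j'$ chain and $x'$ is part of a level-$(j-1)$ chain, or $x$ is part of a level-$(j-1)$ chain and $x'$ is part of a level-$j'$ chain.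
   Formalization: If a non-faulty robot exists, x_n − x_0 > V is assumed (the claim fails for positions 0, 1/2, 1 with V = 1); existence at time t of the primary chain, anchored at x_0 and x_n, is an explicit hypothesis, which leaves no robots outside [x_0, x_n]. *)

(* Defs.v *)
(* MathComp / MathComp-Analysis *)
From HB Require Import structures.
From mathcomp Require Import all_boot all_order all_algebra.
From mathcomp Require Import all_classical all_reals all_analysis.

Set Implicit Arguments.
Unset Strict Implicit.
Unset Printing Implicit Defensive.

Import Order.TTheory GRing.Theory Num.Theory numFieldNormedType.Exports.
Local Open Scope classical_set_scope.
Local Open Scope ring_scope.

(* A configuration [X : 'I_n.+1 -> R] maps each robot to its position.  The
   faulty robots x_0 and x_n are [ord0] and [ord_max]; the indexing of the
   others says nothing about their order on the line.  Robots sharing a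
   position see the same robots and count as one, so neighbourhoods, chains and
   anchors are expressed with the points of the set [codom X] of occupied
   positions. *)

Section Configuration.
Variables (R : realType) (n : nat) (V : R) (X : 'I_n.+1 -> R).

Definition visible (p q : R) : bool := `|p - q| <= V.

(* The default value [p] of the iterated min and max is harmless: when V >= 0,
   a robot at [p] sees itself. *)
Definition lpos (p : R) : R := \big[Num.min/p]_(i | visible p (X i)) X i.
Definition rpos (p : R) : R := \big[Num.max/p]_(i | visible p (X i)) X i.

(* [sorted] relates consecutive entries z_i, z_(i+1) only.  The length m is not
   bounded by n: the primary chain may consist of all n+1 robots, and a
   repetition-free sequence in [codom X] is never longer than that. *)
Definition mutual_chain (z : seq R) : Prop :=
  [/\ {subset z <= codom X}, uniq z
    & sorted (fun p q => (lpos q == p) && (rpos p == q)) z].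

(* The empty chain has no anchors. *)
Definition anchored (z : seq R) (a b : R) : Prop :=
  if z is p :: z' then a = lpos p /\ b = rpos (last p z') else False.

Definition primary_chain (z : seq R) : Prop :=
  [/\ mutual_chain z, anchored z (X ord0) (X ord_max),
      head 0 z = X ord0 & last 0 z = X ord_max].

Definition faulty_pos (p : R) : bool := (p == X ord0) || (p == X ord_max).

Inductive level_chain : nat -> seq R -> Prop :=
| level0_left : level_chain 0 [:: X ord0]
| level0_right : level_chain 0 [:: X ord_max]
| level1 z : primary_chain z -> level_chain 1 z
| level2 c z a b :
    primary_chain c -> mutual_chain z -> anchored z a b ->
    a \in c -> b \in c -> ~~ faulty_pos a || ~~ faulty_pos b ->
    level_chain 2 z
| level_left j j' z a b z1 z2 :
    (2 < j)%N -> (j' < j)%N -> mutual_chain z -> anchored z a b ->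
    level_chain j' z1 -> a \in z1 -> level_chain j.-1 z2 -> b \in z2 ->
    level_chain j z
| level_right j j' z a b z1 z2 :
    (2 < j)%N -> (j' < j)%N -> mutual_chain z -> anchored z a b ->
    level_chain j.-1 z1 -> a \in z1 -> level_chain j' z2 -> b \in z2 ->
    level_chain j z.

End Configuration.

Section Dynamics.
Variables (R : realType) (n : nat) (V : R) (x : nat -> 'I_n.+1 -> R).

Definition faulty (i : 'I_n.+1) : bool := (i == ord0) || (i == ord_max).

Definition midpoint_rule : Prop := forall s i, ~~ faulty i ->
  x s.+1 i = (lpos V (x s) (x s i) + rpos V (x s) (x s i)) / 2.

Definition no_inclusion (s : nat) : Prop := forall i j,
  visible V (x s.+1 i) (x s.+1 j) -> visible V (x s i) (x s j).

Definition no_merging (s : nat) : Prop := forall i j,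
  x s.+1 i = x s.+1 j -> x s i = x s j.

Definition no_crossing (s : nat) : Prop := forall i j,
  x s i < x s j -> ~ (x s.+1 j < x s.+1 i).

Definition all_inside (s : nat) : Prop := forall i,
  x s ord0 <= x s i <= x s ord_max.

(* "At most one" outsider on a side means at most one occupied position. *)
Definition outsiders (s : nat) : Prop :=
  [/\ forall i j, x s i < x s ord0 -> x s j < x s ord0 -> x s i = x s j,
      forall i j, x s ord_max < x s i -> x s ord_max < x s j -> x s i = x s j,
      forall i, x s i < x s ord0 ->
        (forall s', (s <= s')%N -> x s' i < x s' ord0) /\
        x s' i @[s' --> \oo] --> x s ord0
    & forall i, x s ord_max < x s i ->
        (forall s', (s <= s')%N -> x s' ord_max < x s' i) /\
        x s' i @[s' --> \oo] --> x s ord_max].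

Definition size_stable (t0 : nat) : Prop := forall s, (t0 <= s)%N ->
  [/\ no_inclusion s, no_merging s, no_crossing s
    & all_inside s \/ outsiders s].

End Dynamics.

(* Main.v *)
(** Size-stability freezes the visibility graph and the strict order of the
  robots, so from then on the motion is linear.  A Banach limit of the
  trajectories assigns to every position [p] a value [Y p] that is harmonic for
  the neighbours [lpos] and [rpos], weakly increasing, and has gaps at most [V]
  between visible and at least [V] between invisible positions.  [Y] is in fact
  strictly increasing: since nothing merges, a tie forces gaps equal to [V],
  which propagate to both faulty robots and force [Y p = p].

  Among the positions that have no level choose one where the gap of [Y] to its
  neighbours is largest, and the leftmost such one.  Its left neighbour has a
  level, and following right neighbours never breaks mutuality, because a
  non-mutual step strictly increases the gap.  This yields a mutual chain with
  both anchors levelled, a contradiction. *)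

Require Import Defs.
From HB Require Import structures.
From mathcomp Require Import all_boot all_order all_algebra.
From mathcomp Require Import all_classical all_reals all_analysis.
From mathcomp Require Import ring lra.

Set Implicit Arguments.
Unset Strict Implicit.
Unset Printing Implicit Defensive.

Import Order.TTheory GRing.Theory Num.Theory numFieldNormedType.Exports.
Local Open Scope ring_scope.

(** * Banach limits of bounded real sequences *)

Section BanachLimit.
Local Open Scope classical_set_scope.

Lemma fmap_ultra (T U : Type) (f : T -> U) (F : set_system T) :
  UltraFilter F -> UltraFilter (f @ F).
Proof.
move=> FU; split; first exact: fmap_proper_filter.
move=> G GP FG; apply/seteqP; split=> // A GA.
have [//|FnA] := in_ultra_setVsetC (f @^-1` A) FU.
have GnA : G (~` A) by exact: FG.
by case: (@filter_not_empty _ G _); rewrite -(setICr A); exact: filterI.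
Qed.

Context {R : realType}.
Implicit Types u v : R ^nat.

Lemma ultra_bounded_cvg (F : set_system nat) u (M : R) :
  UltraFilter F -> (forall s, `|u s| <= M) -> exists l : R, u @ F --> l.
Proof.
move=> FU uM; have := @segment_compact R (- M) M.
rewrite compact_ultra => /(_ _ (fmap_ultra u FU)) [].
  apply: (@filterE nat F _ (u @^-1` _)) => s /=; rewrite in_itv /=; have := uM s.
  by rewrite ler_norml.
by move=> l [_ ul]; exists l.
Qed.

Lemma arithmetic_mean_bounded u (M : R) :
  (forall s, `|u s| <= M) -> forall s, `|arithmetic_mean u s| <= M.
Proof.
move=> uM s; rewrite /arithmetic_mean /= normrM ger0_norm ?invr_ge0 ?ler0n//.
rewrite mulrC ler_pdivrMr ?ltr0n// /series /= mulr_natr.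
apply: le_trans (ler_norm_sum _ _ _) _.
rewrite -[X in _ *+ X]subn0 -sumr_const_nat.
by apply: ler_sum_nat => i _.
Qed.

Lemma arithmetic_mean_shift u (s : nat) :
  arithmetic_mean (fun k => u k.+1) s =
  arithmetic_mean u s + s.+1%:R^-1 * (u s.+1 - u 0%N).
Proof.
rewrite /arithmetic_mean /= -mulrDr; congr (_ * _); rewrite /series /=.
have E : \sum_(0 <= i < s.+1) u i + u s.+1 =
    u 0%N + \sum_(0 <= i < s.+1) u i.+1.
  by rewrite -big_nat_recr//= big_nat_recl.
by rewrite addrA E [u 0%N + _]addrC addrK.
Qed.

(* The limit along an ultrafilter of the Cesaro means; averaging makes it
   invariant under shifts. *)
Lemma banach_limit : exists B : R ^nat -> R,
  [/\ forall c, B (fun=> c) = c,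
      forall u v M, (forall s, `|u s| <= M) -> (forall s, `|v s| <= M) ->
        (forall s, u s <= v s) -> B u <= B v,
      forall u v M, (forall s, `|u s| <= M) -> (forall s, `|v s| <= M) ->
        forall a b, B (fun s => a * u s + b * v s) = a * B u + b * B v
    & forall u M, (forall s, `|u s| <= M) -> B (fun s => u s.+1) = B u].
Proof.
(* Along an ultrafilter refining [\oo] every bounded sequence converges, by compactness of
   [[-M, M]]. *)
have [F [FU subF]] := @ultraFilterLemma nat \oo _.
pose B u : R := lim (arithmetic_mean u @ F).
have cvgB u M : (forall s, `|u s| <= M) -> arithmetic_mean u @ F --> B u.
  move=> /arithmetic_mean_bounded uM.
  by have [l ul] := ultra_bounded_cvg FU uM; apply: cvgP ul.
have BE u l : arithmetic_mean u @ F --> (l : R) -> B u = l.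
  exact: cvg_lim.
have meanD a b u v : arithmetic_mean (fun s => a * u s + b * v s) =
    (fun s => a * arithmetic_mean u s + b * arithmetic_mean v s).
  apply/funext => s; rewrite /arithmetic_mean /= /series /= big_split /=.
  by rewrite -!mulr_sumr; ring.
exists B; split.
- move=> c; apply: BE; rewrite (_ : arithmetic_mean _ = fun=> c).
    exact: cvg_cst.
  apply/funext => s; rewrite /arithmetic_mean /= /series /= sumr_const_nat subn0.
  by rewrite -[c *+ _]mulr_natl mulKf.
- move=> u v M uM vM uv; apply: (ler_cvg_to (cvgB _ _ uM) (cvgB _ _ vM)).
  apply: filterE => s; rewrite /arithmetic_mean /= ler_pM2l ?invr_gt0 ?ltr0n//.
  by apply: ler_sum_nat.
- move=> u v M uM vM a b; apply: BE; rewrite meanD.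
  by apply: cvgD; apply: cvgMl_tmp; apply: cvgB; eassumption.
- move=> u M uM; apply: BE.
  (* The shift changes the mean by [(u s.+1 - u 0) / s.+1], at most [2 * M / s.+1] in absolute
     value. *)
  rewrite (funext (arithmetic_mean_shift u)) -[B u]addr0.
  apply: cvgD; first exact: cvgB uM.
  have hF : @harmonic R @ F --> 0.
    by move=> A /(@cvg_harmonic R); exact: subF.
  have h0 (k : R) : (fun s => k * harmonic s) @ F --> 0.
    by rewrite -[X in _ --> X](mulr0 k); apply: cvgM hF; exact: cvg_cst.
  apply: squeeze_cvgr (h0 (- (2 * M))) (h0 (2 * M)).
  apply: filterE => s; rewrite /harmonic /=.
  have i0 : 0 <= s.+1%:R^-1 :> R by rewrite invr_ge0.
  have := uM s.+1; have := uM 0%N; rewrite !ler_norml => /andP[? ?] /andP[? ?].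
  by rewrite [s.+1%:R^-1 * _]mulrC !ler_wpM2r//; lra.
Qed.

End BanachLimit.

(** The number of [r]-successors in [s] drops along [r]. With [<] for [r] the induction hypothesis
    concerns larger positions, with [>] smaller ones. *)
Lemma finite_wf_ind (T : eqType) (s : seq T) (r : rel T) (Q : T -> Prop) :
  irreflexive r -> transitive r ->
  (forall p, p \in s -> (forall q, q \in s -> r p q -> Q q) -> Q p) ->
  forall p, p \in s -> Q p.
Proof.
move=> rI rT step p; have [k] := ubnP (count (r p) s).
elim: k p => // k IH p cpk ps; apply: (step p ps) => q qs rpq.
apply: IH => //; rewrite ltnS in cpk; apply: leq_trans cpk.
have sub : subpred (r q) (r p) by move=> x; exact: rT.
apply: (@leq_trans (count (predU (r q) (pred1 q)) s)); last first.
  by apply: sub_count => x /orP[/sub|/eqP->].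
have := count_predUI (r q) (pred1 q) s.
rewrite (@eq_count _ (predI _ _) pred0) => [|x /=]; last first.
  by apply/andP => -[rqx /eqP xq]; move: rqx; rewrite xq rI.
by rewrite count_pred0 addn0 => ->; rewrite -addn1 leq_add2l -has_count has_pred1.
Qed.

(** * Extremal visible positions *)

Section Visibility.
Context {R : realType} {n : nat} {V : R} {X : 'I_n.+1 -> R}.
Hypothesis V_ge0 : 0 <= V.

Lemma visiblexx (p : R) : visible V p p.
Proof. by rewrite /visible subrr normr0. Qed.

Lemma visibleC (p q : R) : visible V p q = visible V q p.
Proof. by rewrite /visible distrC. Qed.

Lemma visible_le (p q : R) : p <= q -> visible V p q = (q <= p + V).
Proof. by move=> pq; rewrite /visible ler_norml; lra. Qed.

Lemma lpos_le (p q : R) : q \in codom X -> visible V p q -> lpos V X p <= q.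
Proof. by move=> /codomP[k ->]; exact: bigmin_le_cond. Qed.

Lemma rpos_ge (p q : R) : q \in codom X -> visible V p q -> q <= rpos V X p.
Proof. by move=> /codomP[k ->]; exact: le_bigmax_cond. Qed.

Lemma lposE (p q : R) : p \in codom X -> q \in codom X -> visible V p q ->
  (forall k, visible V p (X k) -> q <= X k) -> lpos V X p = q.
Proof.
move=> /codomP[i ->] qX vq qmin; apply/le_anti; rewrite lpos_le//=.
by apply: le_bigmin => [|k]; [exact/qmin/visiblexx|exact: qmin].
Qed.

Lemma rposE (p q : R) : p \in codom X -> q \in codom X -> visible V p q ->
  (forall k, visible V p (X k) -> X k <= q) -> rpos V X p = q.
Proof.
move=> /codomP[i ->] qX vq qmax; apply/le_anti; rewrite rpos_ge// andbT.
by apply: bigmax_le => [|k]; [exact/qmax/visiblexx|exact: qmax].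
Qed.

Lemma lposP (p : R) : p \in codom X ->
  lpos V X p \in codom X /\ visible V p (lpos V X p).
Proof.
move=> pX; have [i pi] := codomP pX.
have [//|j vj jmin] := @arg_minP _ _ _ i (fun k => visible V p (X k)) X.
  by rewrite pi visiblexx.
by rewrite (@lposE _ (X j)) ?codom_f.
Qed.

Lemma rposP (p : R) : p \in codom X ->
  rpos V X p \in codom X /\ visible V p (rpos V X p).
Proof.
move=> pX; have [i pi] := codomP pX.
have [//|j vj jmax] := @arg_maxP _ _ _ i (fun k => visible V p (X k)) X.
  by rewrite pi visiblexx.
by rewrite (@rposE _ (X j)) ?codom_f.
Qed.

Lemma lpos_le_id (p : R) : p \in codom X -> lpos V X p <= p.
Proof. by move=> pX; exact/lpos_le/visiblexx. Qed.

Lemma rpos_ge_id (p : R) : p \in codom X -> p <= rpos V X p.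
Proof. by move=> pX; exact/rpos_ge/visiblexx. Qed.

(** Either [p <= lpos q], or [lpos q < p <= q]; in the latter case [lpos q], within [V] of [q], is
    also within [V] of [p]. *)
Lemma lpos_mono (p q : R) : p \in codom X -> q \in codom X -> p <= q ->
  lpos V X p <= lpos V X q.
Proof.
move=> pX qX pq; have [lX lv] := lposP qX; have lq := lpos_le_id qX.
have [ple|ltp] := leP p (lpos V X q); first exact: le_trans (lpos_le_id pX) ple.
apply: lpos_le => //; move: lv; rewrite /visible !ler_norml; lra.
Qed.

Lemma rpos_mono (p q : R) : p \in codom X -> q \in codom X -> p <= q ->
  rpos V X p <= rpos V X q.
Proof.
move=> pX qX pq; have [rX rv] := rposP pX; have rp := rpos_ge_id pX.
have [rle|ltr] := leP (rpos V X p) q; first exact: le_trans rle (rpos_ge_id qX).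
apply: rpos_ge => //; move: rv; rewrite /visible !ler_norml; lra.
Qed.

End Visibility.

(** * Harmonic functions on the occupied positions *)

Section Harmonic.
Context {R : realType} {n : nat} {V L : R} {X : 'I_n.+1 -> R} {Y : R -> R}.
Local Notation P := (codom X).
Local Notation lpos := (lpos V X).
Local Notation rpos := (rpos V X).
Hypotheses (V_ge0 : 0 <= V) (L_gt0 : 0 < L).
Hypotheses (inside : forall p, p \in P -> 0 <= p <= L).
Hypotheses (lpos_lt : forall p, p \in P -> 0 < p -> lpos p < p).
Hypotheses (rpos_gt : forall p, p \in P -> p < L -> p < rpos p).
(** Interior positions with the same two neighbours would merge at the next step. *)
Hypotheses (no_twins : forall p q, p \in P -> q \in P ->
  0 < p -> p < q -> q < L -> lpos p = lpos q -> rpos p <> rpos q).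
Hypotheses (P0 : 0 \in P) (PL : L \in P) (Y0 : Y 0 = 0) (YL : Y L = L).
Hypothesis Y_harmonic :
  forall p, p \in P -> 0 < p < L -> Y p = (Y (lpos p) + Y (rpos p)) / 2.
Hypothesis Y_mono : forall p q, p \in P -> q \in P -> p <= q -> Y p <= Y q.
Hypothesis Y_visible : forall p q, p \in P -> q \in P -> p <= q ->
  visible V p q -> Y q <= Y p + V.
Hypothesis Y_invisible : forall p q, p \in P -> q \in P -> p <= q ->
  ~~ visible V p q -> Y p + V <= Y q.

Let lP p (pP : p \in P) := (lposP V_ge0 pP).1.
Let lV p (pP : p \in P) := (lposP V_ge0 pP).2.
Let rP p (pP : p \in P) := (rposP V_ge0 pP).1.
Let rV p (pP : p \in P) := (rposP V_ge0 pP).2.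
Let l_le p (pP : p \in P) := lpos_le_id V_ge0 pP.
Let r_ge p (pP : p \in P) := rpos_ge_id V_ge0 pP.

Let Y_l p (pP : p \in P) : Y (lpos p) <= Y p <= Y (lpos p) + V.
Proof.
by rewrite Y_mono ?Y_visible// ?lP ?l_le// visibleC lV.
Qed.

Let Y_r p (pP : p \in P) : Y p <= Y (rpos p) <= Y p + V.
Proof.
by rewrite Y_mono ?Y_visible// ?rP ?r_ge// rV.
Qed.

(** Going from [L] leftwards, [Y p] averages a nonnegative and a positive value. *)
Lemma harmonic_gt0 p : p \in P -> 0 < p -> 0 < Y p.
Proof.
move: p; apply: (@finite_wf_ind _ _ <%R) => [||p pP IH p0].
- exact: ltxx.
- exact: lt_trans.
have /andP[_] := inside pP; rewrite le_eqVlt => /predU1P[->|pL].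
  by rewrite YL.
rewrite Y_harmonic ?p0// divr_gt0// ltr_wpDl//.
  by rewrite -Y0 Y_mono ?lP//; have /andP[] := inside (lP pP).
apply: IH; [exact: rP|exact: rpos_gt|exact: lt_trans p0 (rpos_gt pP pL)].
Qed.

Lemma harmonic_ltL p : p \in P -> p < L -> Y p < L.
Proof.
move: p; apply: (@finite_wf_ind _ _ >%R) => [||p pP IH pL].
- exact: ltxx.
- by move=> y x z xy yz; exact: lt_trans yz xy.
have /andP[] := inside pP; rewrite le_eqVlt => /predU1P[<-|p0].
  by rewrite Y0.
have lL : Y (lpos p) < L.
  apply: IH; [exact: lP|exact: lpos_lt|exact: lt_trans (lpos_lt pP p0) pL].
have rL : Y (rpos p) <= L.
  by rewrite -YL Y_mono ?rP//; have /andP[] := inside (rP pP).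
by rewrite Y_harmonic ?p0//; lra.
Qed.

(* A gap equal to the maximal value [V] propagates to all later gaps, so that
   [Y] lags behind the actual positions, which advance by at most [V]. *)
Lemma right_tight p : p \in P -> p < L -> Y (rpos p) = Y p + V -> Y p <= p.
Proof.
move: p; apply: (@finite_wf_ind _ _ <%R) => [||p pP IH pL tp].
- exact: ltxx.
- exact: lt_trans.
have rvp : rpos p <= p + V by rewrite -visible_le ?r_ge ?rV.
have /andP[_] := inside (rP pP); rewrite le_eqVlt => /predU1P[rL|rL].
  by move: tp rvp; rewrite rL YL; lra.
suff : Y (rpos p) <= rpos p by lra.
have pr := rpos_gt pP pL.
apply: IH => //; first exact: rP.
have p_ge0 : 0 <= p by have /andP[] := inside pP.
have /Y_harmonic : rpos p \in P by exact: rP.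
rewrite (le_lt_trans p_ge0 pr) rL => /(_ isT).
have /andP[_ Yr] := Y_r (rP pP).
(* The left gap at [rpos p] is thus at least [V]; harmonicity passes this on to its right gap. *)
have : Y (lpos (rpos p)) <= Y p.
  by rewrite Y_mono ?lP ?rP// lpos_le// visibleC rV.
lra.
Qed.

Lemma left_tight p : p \in P -> 0 < p -> Y p = Y (lpos p) + V -> p <= Y p.
Proof.
move: p; apply: (@finite_wf_ind _ _ >%R) => [||p pP IH p0 tp].
- exact: ltxx.
- by move=> y x z xy yz; exact: lt_trans yz xy.
have lvp : p <= lpos p + V by rewrite -visible_le ?l_le ?lP// visibleC lV.
have /andP[] := inside (lP pP); rewrite le_eqVlt => /predU1P[l0|l0].
  by move: tp lvp; rewrite -l0 Y0; lra.
suff : lpos p <= Y (lpos p) by lra.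
have pl := lpos_lt pP p0.
apply: IH => //; first exact: lP.
have p_leL : p <= L by have /andP[] := inside pP.
have /Y_harmonic : lpos p \in P by exact: lP.
rewrite (lt_le_trans pl p_leL) l0 => /(_ isT).
have /andP[_ Yl] := Y_l (lP pP).
have : Y p <= Y (rpos (lpos p)).
  by rewrite Y_mono ?rP ?lP// rpos_ge// visibleC lV.
lra.
Qed.

(** Harmonicity makes the left gap [V] as well, so the bounds from both sides meet. *)
Lemma tight_fixed p : p \in P -> 0 < p < L -> Y (rpos p) = Y p + V -> Y p = p.
Proof.
move=> pP /andP[p0 pL] tp; apply/le_anti; rewrite right_tight//=.
by apply: left_tight => //; have := Y_harmonic pP; rewrite p0 pL => /(_ isT); lra.
Qed.

Lemma harmonic_strict p q : p \in P -> q \in P -> p < q -> Y p < Y q.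
Proof.
move=> pP qP pq; rewrite lt_neqAle Y_mono ?(ltW pq)// andbT; apply/eqP => Ypq.
have /andP[p_ge0 _] := inside pP; have /andP[_ q_leL] := inside qP.
have p0 : 0 < p.
  rewrite lt_neqAle p_ge0 andbT; apply/eqP => p0; move: Ypq; rewrite -p0 Y0.
  have /(harmonic_gt0 qP) : 0 < q by rewrite p0.
  by move=> + Yq; rewrite -Yq ltxx.
have qL : q < L.
  rewrite lt_neqAle q_leL andbT; apply/eqP => qL; move: Ypq; rewrite qL YL.
  have /(harmonic_ltL pP) : p < L by rewrite -qL.
  by move=> + Yp; rewrite Yp ltxx.
have q0 := lt_trans p0 pq; have pL := lt_trans pq qL.
have Hp : Y p = (Y (lpos p) + Y (rpos p)) / 2 by rewrite -Y_harmonic ?p0.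
have Hq : Y q = (Y (lpos q) + Y (rpos q)) / 2 by rewrite -Y_harmonic ?q0.
have lpq : lpos p <= lpos q by rewrite lpos_mono// ltW.
have rpq : rpos p <= rpos q by rewrite rpos_mono// ltW.
have Ylpq : Y (lpos p) <= Y (lpos q) by rewrite Y_mono ?lP.
have Yrpq : Y (rpos p) <= Y (rpos q) by rewrite Y_mono ?rP.
have /andP[_ Yrp] := Y_r pP; have /andP[_ Ylq] := Y_l qP.
(* By monotonicity a tight gap at [p] gives one at [q]; then [p = Y p = Y q = q]. *)
suff t : Y (rpos p) = Y p + V.
  have pE : Y p = p by apply: tight_fixed; rewrite ?p0.
  have qE : Y q = q by apply: tight_fixed; rewrite ?q0//; lra.
  by move: pq; rewrite -pE -qE Ypq ltxx.
(* With a common left neighbour, [rpos q] is invisible from [p]; otherwise [lpos p] is invisible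
   from [q]. Either way a gap of at least [V] appears. *)
have [lE|lN] := eqVneq (lpos p) (lpos q).
  have rN : rpos p < rpos q.
    by rewrite lt_neqAle rpq andbT; apply/eqP/(no_twins pP qP).
  have : Y p + V <= Y (rpos q).
    have prq : p <= rpos q by rewrite (le_trans (r_ge pP)).
    rewrite Y_invisible ?rP//; apply: contraTN rN => v.
    by rewrite -leNgt rpos_ge ?rP.
  lra.
have lN' : lpos p < lpos q by rewrite lt_neqAle lN.
have : Y (lpos p) + V <= Y q.
  have lpq' : lpos p <= q by rewrite (le_trans lpq) ?l_le.
  rewrite Y_invisible ?lP//; apply: contraTN lN' => v.
  by rewrite -leNgt lpos_le ?lP// visibleC.
lra.
Qed.

(** [S] stands for the positions that have a level; only closure under anchored chains matters here,
    not the numbering of levels. *)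
Lemma chain_closed_full (S : R -> Prop) : S 0 -> S L ->
  (forall z a b p, mutual_chain V X z -> anchored V X z a b -> S a -> S b ->
    p \in z -> S p) ->
  forall p, p \in P -> S p.
Proof.
move=> S0 SL Scl p pP; apply: contrapT => SNp.
pose U := [seq p <- P | `[< ~ S p >]].
have UE q : q \in U -> [/\ q \in P, ~ S q, 0 < q & q < L].
  rewrite mem_filter => /andP[/asboolP SNq qP]; split=> //.
    have /andP[+ _] := inside qP; rewrite le_eqVlt => /predU1P[q0|//].
    by case: SNq; rewrite -q0.
  have /andP[_] := inside qP; rewrite le_eqVlt => /predU1P[qL|//].
  by case: SNq; rewrite qL.
have UI q : q \in P -> ~ S q -> q \in U.
  by move=> qP SNq; rewrite mem_filter qP andbT; apply/asboolP.
pose d q := Y (rpos q) - Y q.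
(* [r]-maximal positions have the largest gap and are leftmost among those. *)
pose r : rel R := fun q q' => (d q < d q') || (d q == d q') && (q' < q).
suff: forall q, q \in U -> False by apply; exact: UI pP SNp.
apply: (@finite_wf_ind _ U r (fun=> False)) => {p pP SNp}.
- by move=> q; rewrite /r !ltxx andbF.
- by rewrite /r => y x z; lra.
move=> p pU pmax; have [pP SNp p0 pL] := UE _ pU.
have dmax q : q \in U -> d q <= d p.
  by move=> qU; rewrite leNgt; apply/negP => dpq; apply: (pmax q); rewrite /r ?dpq.
have dE q : q \in P -> 0 < q -> q < L -> d q = Y q - Y (lpos q).
  by move=> qP q0 qL; rewrite /d [Y q]Y_harmonic ?q0//; lra.
(* Otherwise [lpos p] lies in [U], further left than [p] and with a gap at least as large. *)
have Sl : S (lpos p).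
  apply: contrapT => SNl; have lU := UI _ (lP pP) SNl.
  have := pmax _ lU; rewrite /r lpos_lt// andbT; apply.
  have Yprl : Y p <= Y (rpos (lpos p)).
    by rewrite Y_mono ?rP ?lP// rpos_ge// visibleC lV.
  by move: (dE _ pP p0 pL); rewrite orbC -le_eqVlt /d; lra.
have [z [ez ltz zP Sz]] : exists z,
    [/\ path (fun p q => (lpos q == p) && (rpos p == q)) p z,
        path <%R p z, {subset p :: z <= P} & S (rpos (last p z))].
  (* Generalised to all positions of [U] with maximal gap, so that the induction can walk right
     until it meets [S]. *)
  suff : forall q, q \in U -> d q = d p -> exists z,
    [/\ path (fun p q => (lpos q == p) && (rpos p == q)) q z,
        path <%R q z, {subset q :: z <= P} & S (rpos (last q z))] by exact.
  apply: (@finite_wf_ind _ _ <%R) => [||q qU IH dq].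
  - exact: ltxx.
  - exact: lt_trans.
  have [qP SNq q0 qL] := UE _ qU.
  have [Sr|SNr] := pselect (S (rpos q)).
    by exists [::]; split=> // x; rewrite mem_seq1 => /eqP ->.
  have rU := UI _ (rP qP) SNr; have [rqP _ r0 rL] := UE _ rU.
  (* If [lpos (rpos q) < q], strictness of [Y] makes the gap at [rpos q] exceed the maximum. *)
  have lr : lpos (rpos q) = q.
    have : lpos (rpos q) <= q by rewrite lpos_le// visibleC rV.
    rewrite le_eqVlt => /predU1P[//|/harmonic_strict].
    move=> /(_ (lP rqP) qP); have := dmax _ rU; rewrite -dq dE// /d; lra.
  have dr : d (rpos q) = d p by rewrite -dq dE// lr.
  have [z [ez ltz zP Sz]] := IH _ rU (rpos_gt qP qL) dr.
  exists (rpos q :: z); split; rewrite /= ?lr ?eqxx ?rpos_gt//.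
  by move=> x; rewrite inE => /predU1P[->//|]; exact: zP.
apply/SNp/(Scl (p :: z) (lpos p) (rpos (last p z))) => //; last first.
  by rewrite mem_head.
split=> //; exact: lt_sorted_uniq.
Qed.

End Harmonic.

(** * Consequences of a primary chain *)

Section PrimaryChain.
Context {R : realType} {n : nat} {V : R} {X : 'I_n.+1 -> R}.
Hypothesis V_ge0 : 0 <= V.
Local Notation next := (fun p q => (lpos V X q == p) && (rpos V X p == q)).

(** Some consecutive entries satisfy [a <= p < b], and [rpos p >= rpos a = b] by monotonicity. *)
Lemma path_rpos_gt (a p : R) (s : seq R) : path next a s ->
  {subset a :: s <= codom X} -> p \in codom X -> a <= p < last a s ->
  p < rpos V X p.
Proof.
elim: s a => [|b s IH] a /=; first by move=> _ _ _; lra.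
move=> /andP[/andP[_ /eqP rab] bs] sX pX /andP[ap pl].
have [pb|bp] := ltP p b; last first.
  by apply: IH bs _ pX _; rewrite ?bp// => x xs; rewrite sX// inE xs orbT.
have aX : a \in codom X by rewrite sX ?mem_head.
have [bX abv] := rposP V_ge0 aX.
by rewrite -rab in pb *; apply: lt_le_trans pb _; exact: rpos_mono.
Qed.

Lemma path_lpos_lt (a p : R) (s : seq R) : path next a s ->
  {subset a :: s <= codom X} -> p \in codom X -> a < p <= last a s ->
  lpos V X p < p.
Proof.
elim: s a => [|b s IH] a /=; first by move=> _ _ _; lra.
move=> /andP[/andP[/eqP lba _] bs] sX pX /andP[ap pl].
have bX : b \in codom X by rewrite sX// inE mem_head orbT.
have [pb|bp] := leP p b; last first.
  by apply: IH bs _ pX _; rewrite ?bp// => x xs; rewrite sX// inE xs orbT.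
by apply: le_lt_trans ap; rewrite -lba; exact: lpos_mono.
Qed.

Lemma primary_rpos_gt c p : primary_chain V X c -> p \in codom X ->
  X ord0 <= p < X ord_max -> p < rpos V X p.
Proof.
case: c => [[_ []]|a s [[sX _ ps] _ /= a0 lL] pX].
by rewrite -a0 -lL; exact: path_rpos_gt ps sX pX.
Qed.

Lemma primary_lpos_lt c p : primary_chain V X c -> p \in codom X ->
  X ord0 < p <= X ord_max -> lpos V X p < p.
Proof.
case: c => [[_ []]|a s [[sX _ ps] _ /= a0 lL] pX].
by rewrite -a0 -lL; exact: path_lpos_lt ps sX pX.
Qed.

Lemma mem_primary c : primary_chain V X c -> X ord0 \in c /\ X ord_max \in c.
Proof.
case: c => [[_ []]|a s [_ _ /= a0 lL]].
by rewrite -a0 mem_head -lL mem_last.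
Qed.

Lemma primary_ends c : primary_chain V X c ->
  lpos V X (X ord0) = X ord0 /\ rpos V X (X ord_max) = X ord_max.
Proof.
case: c => [[_ []]|a s [_ /= [aE lE] a0 lL]].
by rewrite -{1}a0 -aE -{1}lL -lE.
Qed.

End PrimaryChain.

(** * Assigning levels to chains *)

Section Levels.
Context {R : realType} {n : nat} {V : R} {X : 'I_n.+1 -> R} {c : seq R}.
Hypotheses (V_ge0 : 0 <= V) (X_lt : X ord0 < X ord_max).
Hypothesis far : V < X ord_max - X ord0.
Hypothesis inside : forall p, p \in codom X -> X ord0 <= p <= X ord_max.
Hypothesis cP : primary_chain V X c.

(** The clauses for [2 < j] require one anchor of level [j.-1], hence of level at least 2. *)
Let deep (p : R) := exists j z, [/\ (1 < j)%N, level_chain V X j z & p \in z].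

(* The singleton chain at [x_0] is anchored at [x_0] and at its successor in
   the primary chain, which is not faulty. *)
Lemma deep_left : deep (X ord0).
Proof.
have [l0 _] := primary_ends cP; have [c0 _] := mem_primary cP.
have X0 : X ord0 \in codom X by exact: codom_f.
have r0 : X ord0 < rpos V X (X ord0).
  by apply: primary_rpos_gt cP _ _; rewrite ?lexx.
have r_le : rpos V X (X ord0) <= X ord0 + V.
  by rewrite -visible_le ?(ltW r0)//; have [] := rposP V_ge0 X0.
exists 2%N, [:: X ord0]; split; rewrite ?mem_head//.
apply: (@level2 _ _ _ _ c _ (X ord0) (rpos V X (X ord0))) => //.
- by split=> // x; rewrite mem_seq1 => /eqP ->.
- case: c cP => [[_ []]|a s [[_ _ +] _ /= a0 lL]]; rewrite a0 in lL *.
  case: s lL => [/= X0L|b s _ /= /andP[/andP[_ /eqP ->] _]].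
    by move: X_lt; rewrite X0L ltxx.
  by rewrite inE mem_head orbT.
- rewrite orbC /faulty_pos negb_or (gt_eqF r0) /= lt_eqF//.
  by move: r_le far; lra.
Qed.

Let reached p := p \in c \/ deep p.

(** The anchor of larger level plays the role of the level [j.-1] anchor, on whichever side it
    lies. *)
Lemma level_anchored z a b ja jb za zb : mutual_chain V X z ->
  anchored V X z a b -> (1 < ja)%N || (1 < jb)%N ->
  level_chain V X ja za -> a \in za -> level_chain V X jb zb -> b \in zb ->
  level_chain V X (maxn ja jb).+1 z.
Proof.
move=> mz az jab jaza aza jbzb bzb.
case: (leqP ja jb) jab => [le_jab|lt_jba] j1.
  have jb1 : (1 < jb)%N by case/orP: j1 => // /leq_trans; exact.
  by apply: (@level_left _ _ _ _ jb.+1 ja _ _ _ _ _ _ _ mz az jaza aza jbzb bzb).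
have ja1 : (1 < ja)%N by case/orP: j1 => // /leq_trans; apply; exact: ltnW.
by apply: (@level_right _ _ _ _ ja.+1 jb _ _ _ _ _ _ _ mz az jaza aza jbzb bzb);
  rewrite ltnS // ltnW.
Qed.

(** Two anchors in [c] give level 2 unless [a] is faulty. Then [a] is the position of [x_0], which
    is deep, and a recursive clause applies, as it does whenever an anchor is deep. *)
Lemma reached_closed z a b p : mutual_chain V X z -> anchored V X z a b ->
  reached a -> reached b -> p \in z -> reached p.
Proof.
move=> mz az Ra Rb pz.
suff [j j1 zj] : exists2 j, (1 < j)%N & level_chain V X j z.
  by right; exists j, z.
have c1 := level1 cP.
(* A left anchor is never at [x_n], since [x_n] itself sees a robot further left. *)
have aL : a < X ord_max.
  case: z mz az pz => [//|q z [zX _ _] [-> _] _].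
  have qX : q \in codom X by rewrite zX ?mem_head.
  have /andP[q0 qL] := inside qX; have := lpos_le_id V_ge0 qX.
  move: qL; rewrite le_eqVlt => /predU1P[-> _|qL lq]; last exact: le_lt_trans qL.
  by apply: (primary_lpos_lt V_ge0 cP); rewrite ?codom_f// X_lt lexx.
have top ja za jb zb : level_chain V X ja za -> a \in za ->
    level_chain V X jb zb -> b \in zb -> (1 < ja)%N || (1 < jb)%N ->
    exists2 j, (1 < j)%N & level_chain V X j z.
  move=> jaza aza jbzb bzb j1; exists (maxn ja jb).+1.
    by rewrite ltnS leq_max; case/orP: j1 => /ltnW ->; rewrite ?orbT.
  exact: level_anchored jaza aza jbzb bzb.
case: Ra Rb => [ac|[ja [za [ja1 jaza aza]]]] [bc|[jb [zb [jb1 jbzb bzb]]]].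
- have [aF|aN] := boolP (faulty_pos X a); last first.
    by exists 2%N => //; apply: level2 cP mz az ac bc _; rewrite aN.
  have aE : a = X ord0 by case/orP: aF => /eqP// aE; move: aL; rewrite aE ltxx.
  have [ja [za [ja1 jaza aza]]] := deep_left.
  by rewrite -aE in aza; apply: top jaza aza c1 bc _; rewrite ja1.
- by apply: top c1 ac jbzb bzb _; rewrite jb1 orbT.
- by apply: top jaza aza c1 bc _; rewrite ja1.
- by apply: top jaza aza jbzb bzb _; rewrite ja1.
Qed.

Lemma level_closure (full : forall S : R -> Prop, S (X ord0) -> S (X ord_max) ->
    (forall z a b p, mutual_chain V X z -> anchored V X z a b -> S a -> S b ->
      p \in z -> S p) -> forall p, p \in codom X -> S p) p :
  p \in codom X -> exists j z, level_chain V X j z /\ p \in z.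
Proof.
have [c0 cL] := mem_primary cP.
move=> pX; have : reached p.
  by apply: full pX; [left|left|exact: reached_closed].
case=> [pc|[j [z [_ zj pz]]]]; last by exists j, z.
by exists 1%N, c; split=> //; exact: level1.
Qed.

End Levels.

(** * Persistence of visibility and order from a stable time on *)

Section Persistence.
Context {R : realType} {n : nat} {V L : R} {x : nat -> 'I_n.+1 -> R} {t : nat}.
Hypotheses (V_gt0 : 0 < V) (L_gt0 : 0 < L).
Hypotheses (x_left : forall s, x s ord0 = 0) (x_right : forall s, x s ord_max = L).
Hypothesis x_step : midpoint_rule V x.
Hypothesis t_stable : size_stable V x t.

Let V_ge0 : 0 <= V := ltW V_gt0.

Lemma x_faulty s i : faulty i -> x s.+1 i = x s i.
Proof. by case/orP => /eqP ->; rewrite ?x_left ?x_right. Qed.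

Lemma robot_bounds s i : [/\ lpos V (x s) (x s i) <= x s i,
  x s i <= rpos V (x s) (x s i), x s i - V <= lpos V (x s) (x s i)
  & rpos V (x s) (x s i) <= x s i + V].
Proof.
have iX : x s i \in codom (x s) by exact: codom_f.
have l_le := lpos_le_id V_ge0 iX; have r_ge := rpos_ge_id V_ge0 iX.
have [_ lv] := lposP V_ge0 iX; have [_ rv] := rposP V_ge0 iX.
rewrite l_le r_ge -visible_le// rv; split=> //.
by move: lv; rewrite visibleC visible_le//; lra.
Qed.

(** From [l_i <= x_j], [r_i <= x_i + V], [x_j - V <= l_j] and [x_i <= r_j] the midpoints satisfy
    [x_i' - x_j' <= V]; the other sign and the faulty cases are similar. *)
Lemma visible_next s i j : visible V (x s i) (x s j) ->
  visible V (x s.+1 i) (x s.+1 j).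
Proof.
move=> vij; have vji : visible V (x s j) (x s i) by rewrite visibleC.
have iX : x s i \in codom (x s) by exact: codom_f.
have jX : x s j \in codom (x s) by exact: codom_f.
have := lpos_le jX vij; have := lpos_le iX vji.
have := rpos_ge jX vij; have := rpos_ge iX vji.
have [] := robot_bounds s i; have [] := robot_bounds s j.
have [fi|fi] := boolP (faulty i); have [fj|fj] := boolP (faulty j);
  rewrite ?(x_faulty _ fi) ?(x_faulty _ fj) ?(x_step _ fi) ?(x_step _ fj)//;
  move: vij; rewrite /visible !ler_norml; lra.
Qed.

Lemma visible_stable s i j : (t <= s)%N ->
  visible V (x s i) (x s j) = visible V (x t i) (x t j).
Proof.
elim: s => [|s IH]; first by rewrite leqn0 => /eqP ->.
rewrite leq_eqVlt => /predU1P[<-//|ts]; rewrite -IH//.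
have [inc _ _ _] := t_stable ts.
by apply/idP/idP; [exact: inc|exact: visible_next].
Qed.

(* A robot to the left of [x_0] would remain invisible to [x_0], hence could not
   converge to it. *)
Lemma stable_inside i : lpos V (x t) 0 = 0 -> rpos V (x t) L = L ->
  0 <= x t i <= L.
Proof.
move=> l0 rL; have iX : x t i \in codom (x t) by exact: codom_f.
have [_ _ _ [|[_ _ outl outr]]] := t_stable (leqnn t).
  by move=> /(_ i); rewrite x_left x_right.
apply/andP; split; rewrite leNgt; apply/negP => out.
  have [|_ xi] := outl i; first by rewrite x_left.
  have : ~~ visible V (x t ord0) (x t i).
    apply/negP => v0i; move: out; rewrite -l0 ltNge lpos_le//.
    by rewrite -(x_left t).
  rewrite x_left in xi.
  move/cvgrPdist_le : xi => /(_ _ V_gt0) [m _ /(_ (maxn m t) (leq_maxl _ _))].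
  move=> /= near; rewrite -(visible_stable _ _ (leq_maxr m t)) => /negP; apply.
  by rewrite x_left.
have [|_ xi] := outr i; first by rewrite x_right.
have : ~~ visible V (x t ord_max) (x t i).
  apply/negP => v0i; move: out; rewrite -{1}rL ltNge rpos_ge//.
  by rewrite -(x_right t).
rewrite x_right in xi.
move/cvgrPdist_le : xi => /(_ _ V_gt0) [m _ /(_ (maxn m t) (leq_maxl _ _))].
move=> /= near; rewrite -(visible_stable _ _ (leq_maxr m t)) => /negP; apply.
by rewrite x_right.
Qed.

Hypothesis inside_t : forall i, 0 <= x t i <= L.

Lemma inside_stable s i : (t <= s)%N -> 0 <= x s i <= L.
Proof.
elim: s i => [|s IH] i; first by rewrite leqn0 => /eqP <-.
rewrite leq_eqVlt => /predU1P[<-//|ts].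
have [fi|fi] := boolP (faulty i); first by rewrite x_faulty// IH.
have iX : x s i \in codom (x s) by exact: codom_f.
have [/codomP[j jE] _] := lposP V_ge0 iX.
have [/codomP[k kE] _] := rposP V_ge0 iX.
by rewrite x_step// jE kE; have := IH j ts; have := IH k ts; lra.
Qed.

Lemma lt_stable s i j : (t <= s)%N -> x t i < x t j -> x s i < x s j.
Proof.
move=> + ij; elim: s => [|s IH]; first by rewrite leqn0 => /eqP <-.
rewrite leq_eqVlt => /predU1P[<-//|ts]; have ltij := IH ts.
have [_ mer cro _] := t_stable ts.
rewrite lt_neqAle leNgt; apply/andP; split; last exact/negP/cro.
by apply/eqP => /mer E; rewrite E ltxx in ltij.
Qed.

Lemma eq_stable s i j : (t <= s)%N -> ~~ faulty i -> ~~ faulty j ->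
  x t i = x t j -> x s i = x s j.
Proof.
move=> + fi fj ij; elim: s => [|s IH]; first by rewrite leqn0 => /eqP <-.
rewrite leq_eqVlt => /predU1P[<-//|ts].
by rewrite !x_step// IH.
Qed.

(* The faulty robots are preferred because a non-faulty robot at the position
   of a faulty one does not stay there. *)
Definition rep (q : R) : 'I_n.+1 :=
  if q == 0 then ord0 else if q == L then ord_max else
  odflt ord0 [pick i | x t i == q].

Lemma repK q : q \in codom (x t) -> x t (rep q) = q.
Proof.
move=> /codomP[i qE]; rewrite /rep.
case: eqP => [->|_]; first exact: x_left.
case: eqP => [->|_]; first exact: x_right.
by case: pickP => [j /eqP //|/(_ i)]; rewrite qE eqxx.
Qed.

Lemma interior_faulty i : 0 < x t i < L -> ~~ faulty i.
Proof. by apply: contraL => /orP[] /eqP ->; rewrite ?x_left ?x_right; lra. Qed.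

Lemma rep0 : rep 0 = ord0. Proof. by rewrite /rep eqxx. Qed.

Lemma repL : rep L = ord_max. Proof. by rewrite /rep eqxx gt_eqF. Qed.

Hypothesis lpos_lt : forall p, p \in codom (x t) -> 0 < p <= L ->
  lpos V (x t) p < p.
Hypothesis rpos_gt : forall p, p \in codom (x t) -> 0 <= p < L ->
  p < rpos V (x t) p.

(** Visibility and strict order are frozen, so only ties matter: robots at [0] never pass to the
    left of [x_0], and robots at an interior position stay together. *)
Lemma lpos_stable s i : (t <= s)%N ->
  lpos V (x s) (x s i) = x s (rep (lpos V (x t) (x t i))).
Proof.
move=> ts; set q := lpos V (x t) (x t i).
have iX : x t i \in codom (x t) by exact: codom_f.
have [qX qv] := lposP V_ge0 iX; rewrite -/q in qX qv.
have qE := repK qX.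
(* A non-faulty robot at [L] may drift to the left of [x_n], so [q = L] has to be excluded. *)
have qL : q < L.
  have /andP[i0 iL] := inside_t i; have qi := lpos_le_id V_ge0 iX.
  move: iL; rewrite le_eqVlt => /predU1P[iL|iL]; last exact: le_lt_trans iL.
  by rewrite /q iL lpos_lt -?iL// iL L_gt0 lexx.
apply: lposE => [||||k]; rewrite ?codom_f// visible_stable// ?qE// => vik.
have : q <= x t k by apply: lpos_le vik; exact: codom_f.
rewrite le_eqVlt => /predU1P[qk|]; last by rewrite -{1}qE => /(lt_stable ts)/ltW.
have q_ge0 : 0 <= q by rewrite qk; have /andP[] := inside_t k.
move: q_ge0; rewrite le_eqVlt => /predU1P[q0|q0].
  by rewrite -q0 rep0 x_left; have /andP[] := inside_stable k ts.
have fq : ~~ faulty (rep q) by rewrite interior_faulty// qE q0.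
have fk : ~~ faulty k by rewrite interior_faulty// -qk q0.
by rewrite (eq_stable ts fq fk) ?qE.
Qed.

Lemma rpos_stable s i : (t <= s)%N ->
  rpos V (x s) (x s i) = x s (rep (rpos V (x t) (x t i))).
Proof.
move=> ts; set q := rpos V (x t) (x t i).
have iX : x t i \in codom (x t) by exact: codom_f.
have [qX qv] := rposP V_ge0 iX; rewrite -/q in qX qv.
have qE := repK qX.
have q0 : 0 < q.
  have /andP[i0 iL] := inside_t i; have qi := rpos_ge_id V_ge0 iX.
  move: i0; rewrite le_eqVlt => /predU1P[i0|i0]; last exact: lt_le_trans qi.
  by rewrite /q -i0 rpos_gt ?i0// -i0 L_gt0 lexx.
apply: rposE => [||||k]; rewrite ?codom_f// visible_stable// ?qE// => vik.
have : x t k <= q by apply: rpos_ge vik; exact: codom_f.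
rewrite le_eqVlt => /predU1P[qk|]; last by rewrite -{1}qE => /(lt_stable ts)/ltW.
have q_leL : q <= L by rewrite -qk; have /andP[] := inside_t k.
move: q_leL; rewrite le_eqVlt => /predU1P[qL|qL].
  by rewrite qL repL x_right; have /andP[] := inside_stable k ts.
have fq : ~~ faulty (rep q) by rewrite interior_faulty// qE q0.
have fk : ~~ faulty k by rewrite interior_faulty// qk q0.
by rewrite (eq_stable ts fk fq) ?qE.
Qed.

Lemma stable_chain_closed_full (S : R -> Prop) : S 0 -> S L ->
  (forall z a b p, mutual_chain V (x t) z -> anchored V (x t) z a b ->
    S a -> S b -> p \in z -> S p) ->
  forall p, p \in codom (x t) -> S p.
Proof.
have [B [Bcst Ble Blin Bshift]] := @banach_limit R.
(* One bound for the trajectories in [[0, L]] and the constants in [[-V, V]]; [B (u q)] will be the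
   harmonic value of [q]. *)
pose M := L + V + 1.
pose u q k := x (t + k)%N (rep q).
have uM q k : `|u q k| <= M.
  have /andP[] := inside_stable (rep q) (leq_addr k t).
  by rewrite /u /M ler_norml; move: V_ge0; lra.
have cM c : - V <= c <= V -> forall k : nat, `|c| <= M.
  by move=> cV _; rewrite /M ler_norml; move: L_gt0; lra.
have BleD p q c : - V <= c <= V -> (forall k, u p k <= u q k + c) ->
    B (u p) <= B (u q) + c.
  move=> cV upq; rewrite -[c in leRHS]Bcst -[B (u q)]mul1r -[B (fun=> c)]mul1r.
  rewrite -(Blin _ _ M)//; last exact: cM.
  apply: (Ble _ _ (M + M)) => [k|k|k]; last by rewrite !mul1r.
    by apply: le_trans (uM p k) _; rewrite lerDl /M; move: L_gt0 V_ge0; lra.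
  by rewrite !mul1r; apply: le_trans (ler_normD _ _) (lerD (uM q k) (cM _ cV k)).
have visible_u p q k : p \in codom (x t) -> q \in codom (x t) ->
    visible V (u p k) (u q k) = visible V p q.
  by move=> pX qX; rewrite visible_stable ?leq_addr// !repK.
have le_u p q k : p \in codom (x t) -> q \in codom (x t) -> p <= q ->
    u p k <= u q k.
  move=> pX qX; rewrite le_eqVlt => /predU1P[->//|pq].
  by apply/ltW/lt_stable; rewrite ?leq_addr// !repK.
have V0 : - V <= 0 <= V by move: V_ge0; lra.
have VV : - V <= V <= V by move: V_ge0; lra.
have VN : - V <= - V <= V by move: V_ge0; lra.
apply: (@chain_closed_full _ _ V L (x t) (fun q => B (u q))) => //.
- by move=> p /codomP[i ->].
- move=> p pX p0; apply: lpos_lt; rewrite // p0.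
  by have /codomP[i ->] := pX; have /andP[] := inside_t i.
- move=> p pX pL; apply: rpos_gt; rewrite // pL andbT.
  by have /codomP[i ->] := pX; have /andP[] := inside_t i.
(* Equal neighbours would give equal midpoints at time [t.+1], a merging. *)
- move=> p q pX qX p0 pq qL lE rE.
  have [_ mer _ _] := t_stable (leqnn t).
  have /mer : x t.+1 (rep p) = x t.+1 (rep q).
    by rewrite !x_step ?interior_faulty ?repK ?lE ?rE//; lra.
  by rewrite !repK// => E; rewrite E ltxx in pq.
- by rewrite -(x_left t) codom_f.
- by rewrite -(x_right t) codom_f.
- by rewrite /u rep0; under eq_fun do rewrite x_left; exact: Bcst.
- by rewrite /u repL; under eq_fun do rewrite x_right; exact: Bcst.
- move=> p pX pI.
  (* Shift invariance and linearity of [B] turn the midpoint rule into harmonicity. *)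
  rewrite -(Bshift _ M)//.
  have -> : (fun s => u p s.+1) =
      (fun s => 2^-1 * u (lpos V (x t) p) s + 2^-1 * u (rpos V (x t) p) s).
    apply/funext => s; rewrite /u addnS x_step ?interior_faulty ?repK//.
    rewrite lpos_stable ?leq_addr// rpos_stable ?leq_addr// (repK pX).
    by rewrite -mulrDr mulrC.
  by rewrite (Blin _ _ M)//; lra.
- by move=> p q pX qX pq; rewrite -[leRHS]addr0 BleD// => k; rewrite addr0 le_u.
- move=> p q pX qX pq v; apply: BleD => // k.
  by rewrite -visible_le ?le_u// visible_u.
- move=> p q pX qX pq v; rewrite -lerBrDr BleD// => k.
  move: v; rewrite -(visible_u _ _ k)// visible_le ?le_u// -ltNge; lra.
Qed.

End Persistence.

(** If [x_0] and [x_n] saw each other, they would form the whole primary chain, and a robot strictly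
    between them, anchored at both, would have no level; [far] excludes this. *)
Theorem lemma17 (R : realType) (n : nat) (V L : R) (x : nat -> 'I_n.+1 -> R)
  (V_gt0 : 0 < V)
  (L_gt0 : 0 < L)
  (x_left : forall s, x s ord0 = 0)
  (x_right : forall s, x s ord_max = L)
  (x_step : midpoint_rule V x)
  (far : (1 < n)%N -> V < L)
  (t : nat)
  (t_stable : size_stable V x t)
  (ex_primary : exists z, primary_chain V (x t) z)
  (i : 'I_n.+1) :
  exists j z, level_chain V (x t) j z /\ x t i \in z.
Proof.
(* For [n <= 1] all robots are faulty and have level 0. *)
have [n1|/far VL] := leqP n 1.
  have : faulty i.
    rewrite /faulty -!val_eqE /=; have := ltn_ord i.
    by case: (i : nat) n1 => [//|[|k]]; case: (n) => [|[|m]].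
  by case/orP => /eqP ->; [exists 0%N, [:: x t ord0]|exists 0%N, [:: x t ord_max]];
    split; rewrite ?mem_head//; constructor.
have V_ge0 := ltW V_gt0.
have [c cP] := ex_primary.
have [l0 rL] := primary_ends cP; rewrite x_left x_right in l0 rL.
have inside j := stable_inside V_gt0 x_left x_right x_step t_stable j l0 rL.
apply: (@level_closure _ _ V (x t) c) => //; rewrite ?x_left ?x_right ?subr0//.
- by move=> p /codomP[j ->].
- apply: stable_chain_closed_full => //.
  + by move=> p pX pI; apply: (primary_lpos_lt V_ge0 cP pX); rewrite x_left x_right.
  + by move=> p pX pI; apply: (primary_rpos_gt V_ge0 cP pX); rewrite x_left x_right.
- exact: codom_f.
Qed.
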